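(* For every graph $G$ and every end $\omega$ of $G$ the following assertions are equivalent: (i) The end space of $G$ is not first countable at $\omega$. (ii) There is an uncountable sun in $G$ centred at $\omega$. Moreover, if (ii) holds, then we find an uncountable sun $\{(P^i,\{\omega,\omega^i\}) : i\in I\}$ in $G$ (centred at $\omega$) and an uncountable star-decomposition $(T,\mathcal V)$ of $G$ of finite adhesion such that $\omega$ lives in the central part and every $\omega^i$ lives in its own leaf part (distinct $\omega^i$ living in distinct leaf parts).
   Context: Graphs may be infinite of any cardinality. A ray is a one-way infinite path, a double ray a two-way infinite path; tails are subrays. Two rays in $G$ are equivalent if no finite set of vertices separates them; the equivalence classes are the ends of $G$, and $\Omega(G)$ is the set of ends. For finite $X\subseteq V(G)$ and $\omega\in\Omega(G)$, $C(X,\omega)$ is the unique component of $G-X$ that contains a tail of every ray in $\omega$. The end space of $G$ is $\Omega(G)$ with the topology having as a basis all sets $\Omega(X,C)=\{\omega\in\Omega(G): C(X,\omega)=C\}$, with $X\subseteq V(G)$ finite and $C$ a component of $G-X$. A space is first countable at a point if it has a countable neighbourhood base at that point. A vertex $v$ dominates an end $\omega$ if for one (equivalently, each) ray $R\in\omega$ there is an infinite $v$--$R$ fan in $G$ (infinitely many $v$--$R$ paths pairwise meeting only in $v$). A generalised path in $G$ with endpoints $\omega_1\neq\omega_2\in\Omega(G)$ is a pair $(P,\{\omega_1,\omega_2\})$ where $P\subseteq G$ is one of: a double ray with one tail in $\omega_1$ and another tail in $\omega_2$; a finite path $v_0\ldots v_k$ such that $v_0$ dominates $\omega_1$ and $v_k$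 dominates $\omega_2$; a ray in $\omega_1$ whose first vertex dominates $\omega_2$ (the roles of $\omega_1,\omega_2$ may be exchanged). Two generalised paths $(P,\Psi)$, $(P',\Psi')$ are vertex-disjoint if $P$ and $P'$ are disjoint. A generalised star in $G$ with centre $\omega\in\Omega(G)$ is a collection of pairwise vertex-disjoint generalised paths $\{(P^i,\{\omega,\omega^i\}): i\in I\}$ such that the ends $\omega^i$ ($i\in I$) are pairwise distinct. It is proper, and then called a sun centred at $\omega$, if either every $P^i$ is a double ray or every $P^i$ is a ray in $\omega^i$ whose first vertex dominates $\omega$. A tree-decomposition of $G$ is a pair $(T,\mathcal V)$ of a tree $T$ and a family $\mathcal V=(V_t)_{t\in V(T)}$ of parts $V_t\subseteq V(G)$ such that $V(G)=\bigcup_t V_t$, every edge of $G$ has both endvertices in some $V_t$, and $V_{t_1}\cap V_{t_3}\subseteq V_{t_2}$ whenever $t_2$ lies on the path $t_1Tt_3$. It has finite adhesion if $V_{t_1}\cap V_{t_2}$ is finite for every edge $t_1t_2$ of $T$. An uncountable star-decomposition is a tree-decomposition whose tree is a star $K_{1,\kappa}$ with $\kappa$ an uncountable cardinal; the part of the centre is the central part, the parts of the leaves are the leaf parts. If $(T,\mathcal V)$ has finite adhesion, an end lives in a part $V_t$ if some (equivalently, every) ray in that end has infinitely many vertices in $V_t$. *)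

(* Defs.v *)
From HB Require Import structures.
From mathcomp Require Import all_boot ssralg ssrint.
From mathcomp Require Import all_classical.
From mathcomp Require Import topology_structure.

Set Implicit Arguments.
Unset Strict Implicit.
Unset Printing Implicit Defensive.

Local Open Scope classical_set_scope.

(* Vertex sets may have any cardinality: classically every type carries a
   choiceType structure and every relation is boolean. *)
Record graph : Type := Graph {
  vertex :> choiceType;
  adj : rel vertex;
  adj_sym : symmetric adj;
  adj_irr : irreflexive adj }.

Record fpath (G : graph) : Type := FPath {
  pfirst : G;
  prest : seq G;
  fpathP : path (@adj G) pfirst prest && uniq (pfirst :: prest) }.

Definition pverts (G : graph) (p : fpath G) : seq G := pfirst p :: prest p.

Definition plast (G : graph) (p : fpath G) : G := last (pfirst p) (prest p).

Record ray (G : graph) : Type := Ray {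
  rayv :> nat -> G;
  ray_inj : injective rayv;
  ray_adj : forall n, adj (rayv n) (rayv n.+1) }.

Record dray (G : graph) : Type := DRay {
  drayv :> int -> G;
  dray_inj : injective drayv;
  dray_adj : forall k : int, adj (drayv k) (drayv (k + 1)%R) }.

Definition ABpath (G : graph) (A B : set G) (p : fpath G) : Prop :=
  [set x | x \in pverts p] `&` A = [set pfirst p] /\
  [set x | x \in pverts p] `&` B = [set plast p].

Definition separates (G : graph) (X A B : set G) : Prop :=
  forall p : fpath G, ABpath A B p -> exists2 x, x \in pverts p & X x.

Definition ray_equiv (G : graph) (R R' : ray G) : Prop :=
  ~ exists2 X : set G, finite_set X & separates X (range R) (range R').

Record end_of (G : graph) : Type := End {
  rays_of :> ray G -> Prop;
  endP : exists R, rays_of = ray_equiv R }.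

Definition linked (G : graph) (X : set G) (u v : G) : Prop :=
  exists p : fpath G, [/\ pfirst p = u, plast p = v &
    forall x, x \in pverts p -> ~ X x].

(* Components are identified with their vertex sets. *)
Definition component (G : graph) (X C : set G) : Prop :=
  exists2 u, ~ X u & C = [set v | linked X u v].

(* [endcomp X w C] says that C(X, w) = C. *)
Definition endcomp (G : graph) (X : set G) (w : end_of G) (C : set G) : Prop :=
  component X C /\
  forall R : ray G, w R -> exists n, forall m, (n <= m)%N -> C (R m).

Definition Omega (G : graph) (X C : set G) : set (end_of G) :=
  [set w | endcomp X w C].

Definition end_basis (G : graph) : set_system (end_of G) :=
  [set U | exists X C, [/\ finite_set X, component X C & U = Omega X C]].

Section EndTopology.
Variable G : graph.
Implicit Types (X : set G) (u v : G) (R : ray G) (w : end_of G).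

Lemma linked_refl X u : ~ X u -> linked X u u.
Proof.
move=> Xu; exists (@FPath G u [::] isT); split=> // x.
by rewrite /pverts /= inE => /eqP ->.
Qed.

Lemma linkedP X u v :
  linked X u v <-> exists s, [/\ path (@adj G) u s, last u s = v &
    forall x, x \in u :: s -> ~ X x].
Proof.
split=> [[[a s aus] [/= <- <- Xs]]|[s [ps <- Xs]]].
  by have /andP[ps _] := aus; exists s.
case/shortenP: ps => s' ps' us' ss'.
have h : path (@adj G) u s' && uniq (u :: s') by rewrite ps'.
exists (FPath h); split=> // x; rewrite /pverts /= => xs'; apply: Xs.
move: xs'; rewrite !inE => /orP[->//|xs'].
by rewrite (ss' _ xs') orbT.
Qed.

Lemma linked_trans X u v x : linked X u v -> linked X v x -> linked X u x.
Proof.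
move=> /linkedP[s [ps <- Xs]] /linkedP[t [pt <- Xt]]; apply/linkedP.
exists (s ++ t); split; first by rewrite cat_path ps.
  by rewrite last_cat.
move=> y; rewrite -cat_cons mem_cat => /orP[/Xs //|yt].
by apply: Xt; rewrite inE yt orbT.
Qed.

Lemma linked_sym X u v : linked X u v -> linked X v u.
Proof.
move=> /linkedP[s [ps lsv Xs]]; apply/linkedP.
exists (rev (belast u s)); split.
- by rewrite -lsv rev_path (eq_path (e' := @adj G)) // => y z; exact: adj_sym.
- by case: s {ps Xs} lsv => [//|a s _]; rewrite /= rev_cons last_rcons.
- by move=> y; rewrite -lsv -rev_rcons -lastI mem_rev => /Xs.
Qed.

Lemma linked_sub X X' u v : X `<=` X' -> linked X' u v -> linked X u v.
Proof. by move=> XX' [p [pu pv Xp]]; exists p; split=> // x /Xp ? /XX'. Qed.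

Lemma ray_equiv_refl R : ray_equiv R R.
Proof.
case=> X finX sepX.
have trivial_path n : ABpath (range R) (range R) (@FPath G (R n) [::] isT).
  rewrite /ABpath /pverts /plast /=.
  have E : [set x | x \in [:: R n]] `&` range R = [set R n].
    apply/seteqP; split=> x /= => [[]|->]; first by rewrite inE => /eqP.
    by rewrite inE eqxx; split=> //; exists n.
  by split.
have : infinite_set [set: nat] by exact: infinite_nat.
apply; apply: (@sub_finite_set _ _ (R @^-1` X)).
  move=> n _ /=; have [x] := sepX _ (trivial_path n).
  by rewrite /pverts inE => /eqP ->.
by apply: finite_preimage => // ? ? _ _; exact: ray_inj.
Qed.

Lemma end_nonempty w : exists R, w R.
Proof. by have [R ->] := endP w; exists R; exact: ray_equiv_refl. Qed.

Lemma finite_avoid X R : finite_set X ->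
  exists n, forall m, (n <= m)%N -> ~ X (R m).
Proof.
move=> finX.
have /finite_seqP[s sE] : finite_set (R @^-1` X).
  by apply: finite_preimage => // ? ? _ _; exact: ray_inj.
exists (\max_(i <- s) i).+1 => m lt_m XRm.
have : (R @^-1` X) m by [].
rewrite sE /= => ms.
have : (m <= \max_(i <- s) i)%N by exact: leq_bigmax_seq.
by rewrite leqNgt lt_m.
Qed.

Lemma linked_tail X R n m : (forall k, (n <= k)%N -> ~ X (R k)) -> (n <= m)%N ->
  linked X (R n) (R m).
Proof.
move=> XR /subnKC <-; elim: (m - n)%N => [|d IH].
  by rewrite addn0; apply: linked_refl; exact: XR.
apply: linked_trans IH _; apply/linkedP; exists [:: R (n + d.+1)%N].
split=> //=; first by rewrite addnS ray_adj.
by move=> x; rewrite !inE => /orP[/eqP->|/eqP->]; apply: XR; rewrite leq_addr.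
Qed.

Lemma ray_equiv_linked X R R' : finite_set X -> ray_equiv R R' ->
  exists n n', [/\ forall m, (n <= m)%N -> ~ X (R m),
    forall m, (n' <= m)%N -> ~ X (R' m) & linked X (R n) (R' n')].
Proof.
move=> finX eqR.
have [n Rn] := finite_avoid R finX; have [n' Rn'] := finite_avoid R' finX.
exists n, n'; split=> //.
pose Y := X `|` (R @` `I_n `|` R' @` `I_n').
have finY : finite_set Y.
  by rewrite /Y !finite_setU; do !split=> //;
    apply: finite_image; exact: finite_II.
have /existsNP[p /not_implyP[[pA pB] pY]] : ~ separates Y (range R) (range R').
  by move=> sY; apply: eqR; exists Y.
have {}pY x : x \in pverts p -> ~ Y x by move=> xp Yx; apply: pY; exists x.
have first_p : pfirst p \in pverts p by rewrite inE eqxx.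
have last_p : plast p \in pverts p by exact: mem_last.
have [_ [k _ Rk]] : ([set x | x \in pverts p] `&` range R) (pfirst p).
  by rewrite pA.
have [_ [k' _ Rk']] : ([set x | x \in pverts p] `&` range R') (plast p).
  by rewrite pB.
have nk : (n <= k)%N.
  by rewrite leqNgt; apply/negP => kn; apply: (pY _ first_p); right; left;
    exists k.
have nk' : (n' <= k')%N.
  by rewrite leqNgt; apply/negP => kn; apply: (pY _ last_p); right; right;
    exists k'.
apply: linked_trans (linked_tail Rn nk) _.
apply: linked_trans (linked_sym (linked_tail Rn' nk')).
by exists p; split=> // x /pY xY Xx; apply: xY; left.
Qed.

Lemma endcomp_exists X w : finite_set X -> exists C, endcomp X w C.
Proof.
move=> finX; have [R EE] := endP w.
have [n Rn] := finite_avoid R finX.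
exists [set v | linked X (R n) v]; split; first by exists (R n) => //; exact: Rn.
move=> R' /=; rewrite EE /= => /(ray_equiv_linked finX)[k [k' [Rk Rk' kk']]].
exists k' => m k'm /=.
have nK : linked X (R n) (R (maxn n k)) by apply: linked_tail => //; exact: leq_maxl.
have kK : linked X (R k) (R (maxn n k)) by apply: linked_tail => //; exact: leq_maxr.
apply: linked_trans nK _; apply: linked_trans (linked_sym kK) _.
by apply: linked_trans kk' _; exact: linked_tail.
Qed.

Lemma endcomp_sub X X' w C C' : X `<=` X' -> endcomp X w C -> endcomp X' w C' ->
  C' `<=` C.
Proof.
move=> XX' [[u Xu ->] wC] [[u' Xu' ->] wC'] v /= /(linked_sub XX') u'v.
have [R wR] := end_nonempty w.
have [n nC] := wC _ wR; have [n' nC'] := wC' _ wR.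
have /= uR := nC _ (leq_maxl n n').
have /= /(linked_sub XX') u'R := nC' _ (leq_maxr n n').
exact: linked_trans uR (linked_trans (linked_sym u'R) u'v).
Qed.

Lemma end_basis_cover : \bigcup_(U in @end_basis G) id U = setT.
Proof.
apply/seteqP; split=> // w _.
have [C wC] := endcomp_exists w (@finite_set0 G).
by exists (Omega set0 C) => //; exists set0, C; split=> //; case: wC.
Qed.

Lemma end_basis_join (U U' : set (end_of G)) w :
  end_basis U -> end_basis U' -> id U w -> id U' w ->
  exists W, [/\ end_basis W, id W w & id W `<=` id U `&` id U'].
Proof.
move=> [X [C [finX cC ->]]] [X' [C' [finX' cC' ->]]] /= wC wC'.
have finXX' : finite_set (X `|` X') by rewrite finite_setU.
have [D wD] := endcomp_exists w finXX'.
exists (Omega (X `|` X') D); split=> //.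
  by exists (X `|` X'), D; split=> //; case: wD.
have DC := endcomp_sub (@subsetUl _ X X') wC wD.
have DC' := endcomp_sub (@subsetUr _ X X') wC' wD.
by move=> s [_ sD]; split; split=> // R /sD[n Rn]; exists n => m /Rn ?;
  [exact: DC|exact: DC'].
Qed.

HB.instance Definition _ := gen_eqMixin (end_of G).
HB.instance Definition _ := gen_choiceMixin (end_of G).
HB.instance Definition _ := @isBaseTopological.Build (end_of G)
  (set (end_of G)) (@end_basis G) id end_basis_cover end_basis_join.

End EndTopology.

Definition first_countable_at (T : topologicalType) (x : T) : Prop :=
  exists B : set_system T, [/\ countable B, B `<=` nbhs x &
    forall U, nbhs x U -> exists2 W, B W & W `<=` U].

(* If v lies on R, the only v--R path is the trivial one, so no infinite fan
   exists; the rays of w avoiding v then decide whether v dominates w. *)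
Definition dominates (G : graph) (v : G) (w : end_of G) : Prop :=
  exists2 R : ray G, w R & exists F : set (fpath G),
    [/\ infinite_set F, forall p, F p -> ABpath [set v] (range R) p &
      forall p q, F p -> F q -> p <> q ->
        forall x, x \in pverts p -> x \in pverts q -> x = v].

Definition dray_tail (G : graph) (D : dray G) (R : ray G) : Prop :=
  exists k : int, (forall n, R n = D (k + n%:Z)%R) \/
                  (forall n, R n = D (k - n%:Z)%R).

(* The subgraphs P underlying generalised paths, each given by a
   parametrisation.  Two parametrisations of the same subgraph share vertices,
   so they never both occur in a generalised star. *)
Inductive gcarrier (G : graph) : Type :=
  | GDRay of dray G
  | GPath of fpath G
  | GRay of ray G.

Definition gverts (G : graph) (P : gcarrier G) : set G :=
  match P with
  | GDRay D => range D
  | GPath p => [set x | x \in pverts p]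
  | GRay R => range R
  end.

Definition gen_path (G : graph) (P : gcarrier G) (w1 w2 : end_of G) : Prop :=
  w1 <> w2 /\
  match P with
  | GDRay D => exists R1 R2 : ray G,
      [/\ dray_tail D R1, dray_tail D R2, w1 R1 & w2 R2]
  | GPath p => (dominates (pfirst p) w1 /\ dominates (plast p) w2) \/
               (dominates (pfirst p) w2 /\ dominates (plast p) w1)
  | GRay R => (w1 R /\ dominates (R 0%N) w2) \/ (w2 R /\ dominates (R 0%N) w1)
  end.

Definition gen_star (G : graph) (w : end_of G) (I : Type)
    (P : I -> gcarrier G) (wi : I -> end_of G) : Prop :=
  [/\ forall i, gen_path (P i) w (wi i),
      forall i j, i <> j -> gverts (P i) `&` gverts (P j) = set0 &
      injective wi].

Definition sun (G : graph) (w : end_of G) (I : Type)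
    (P : I -> gcarrier G) (wi : I -> end_of G) : Prop :=
  gen_star w P wi /\
  ((forall i, exists D, P i = GDRay D) \/
   (forall i, exists R, [/\ P i = GRay R, wi i R & dominates (R 0%N) w])).

Definition uncountable_sun (G : graph) (w : end_of G) (I : Type)
    (P : I -> gcarrier G) (wi : I -> end_of G) : Prop :=
  sun w P wi /\ ~ countable [set: I].

Definition tree (T : graph) : Prop :=
  (forall x y : T, exists p : fpath T, pfirst p = x /\ plast p = y) /\
  (forall c : seq T, ~ ((2 < size c)%N /\ ucycle (@adj T) c)).

Definition tree_decomposition (G T : graph) (V : T -> set G) : Prop :=
  [/\ tree T,
      forall v : G, exists t, V t v,
      forall u v : G, adj u v -> exists t, V t u /\ V t v &
      forall (p : fpath T) (t : T), t \in pverts p ->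
        V (pfirst p) `&` V (plast p) `<=` V t].

Definition finite_adhesion (G T : graph) (V : T -> set G) : Prop :=
  forall s t : T, adj s t -> finite_set (V s `&` V t).

(* T is a star K_{1,k} with centre c and k uncountable. *)
Definition uncountable_star (T : graph) (c : T) : Prop :=
  (forall s t : T, adj s t = (s != t) && ((s == c) || (t == c))) /\
  ~ countable [set t : T | t <> c].

Definition uncountable_star_decomposition (G T : graph) (c : T)
    (V : T -> set G) : Prop :=
  tree_decomposition V /\ uncountable_star c.

Definition lives_in (G T : graph) (V : T -> set G) (w : end_of G) (t : T) :
    Prop :=
  exists2 R : ray G, w R & infinite_set (range R `&` V t).

(* Main.v *)
From mathcomp Require Import all_boot all_classical.
From mathcomp Require Import ssralg ssrint topology_structure.
Require Import Defs.

(* Let Z consist of the vertices dominating w and of the vertices of a maximal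
   family of disjoint rays of w.  Every finite X leaves all but finitely many
   vertices of Z in C(X, w), so every other end lives in a component of G - Z.
   Such a component K has a finite neighbourhood: otherwise a breadth-first
   spanning tree of K and Konig's lemma yield a vertex of K dominating w or a
   ray of w inside K, both excluded by the choice of Z.  If the
   neighbourhoods N(K) of the components containing ends cover only countably
   many vertices, then the finite sets of such vertices yield a countable
   neighbourhood base at w.  Otherwise uncountably many vertices h lie in the
   neighbourhoods of distinct K_h and, moreover, all dominate w or lie on
   distinct rays of the family: each h is joined to an end of K_h inside K_h,
   which gives the sun, and the sets K_h together with N(K_h) are the leaf
   parts of the star-decomposition.

   Conversely, a countable base at w involves countably many finite separators;
   their union misses some path of an uncountable sun, and the other end of that
   path then lies in every basic neighbourhood of w, which is absurd. *)

Set Implicit Arguments.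
Unset Strict Implicit.
Unset Printing Implicit Defensive.

Import GRing.Theory.
Local Open Scope classical_set_scope.

(** * Maximal families and countability *)

(** Zorn's lemma: unions of chains of pairwise [r]-related subsets of [P] are again of this kind. It
    supplies disjoint rays, fans and conflict-free index sets. *)
Lemma maximal_pairwise (T : Type) (P : set T) (r : T -> T -> Prop) :
  (forall x y, r x y -> r y x) ->
  exists A : set T, [/\ A `<=` P,
    forall x y, A x -> A y -> x <> y -> r x y &
    forall x, P x -> ~ A x -> exists2 y, A y & ~ r x y].
Proof.
move=> r_sym.
pose good (A : set T) := A `<=` P /\
  forall x y, A x -> A y -> x <> y -> r x y.
have [F goodF totF|A [[AP Ar] Amax]] := @Zorn_bigcup T good.
  split=> [x [A /goodF[AP _]] /AP //|x y [A FA Ax] [B FB By]].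
  have [AB|BA] := totF _ _ FA FB.
    by have [_ h] := goodF _ FB; apply: h => //; exact: AB.
  by have [_ h] := goodF _ FA; apply: h => //; exact: BA.
exists A; split=> // x Px nAx; apply: contrapT => /forall2NP h.
apply: (Amax (x |` A)).
  by split=> [y Ay|]; [right|move/(_ x (or_introl erefl))].
split=> [y [->//|/AP//]|y z [->|Ay] [->|Az]] // yz; last exact: Ar.
  by have [//|/contrapT] := h z.
by apply: r_sym; have [//|/contrapT] := h y.
Qed.

Lemma countable_setU (T : Type) (A B : set T) :
  countable A -> countable B -> countable (A `|` B).
Proof.
move=> cA cB; rewrite -bigcup2inE.
by apply: bigcup_countable => // -[|[|[]]].
Qed.

(* Each element of a maximal [r]-family excludes only countably many others, so
   such a family cannot be countable. *)
Lemma uncountable_pairwise (T : Type) (P : set T) (r : T -> T -> Prop) :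
  ~ countable P -> (forall x y, r x y -> r y x) ->
  (forall x, P x -> countable [set y | P y /\ ~ r x y]) ->
  exists A : set T, [/\ A `<=` P, ~ countable A &
    forall x y, A x -> A y -> x <> y -> r x y].
Proof.
move=> uncP r_sym cr.
have [A [AP Ar Amax]] := maximal_pairwise P r_sym.
exists A; split=> // cA; apply: uncP.
apply: (@sub_countable _ _ _ (A `|` \bigcup_(x in A) [set y | P y /\ ~ r x y])).
  apply: subset_card_le => x Px; have [|nAx] := pselect (A x); first by left.
  by have [y Ay ryx] := Amax x Px nAx; right; exists y => //; split=> // /r_sym.
apply: countable_setU => //.
by apply: bigcup_countable => // x /AP; exact: cr.
Qed.

(** * Components, ends and domination *)

Section Components.
Variable G : graph.
Implicit Types (X Z C D : set G) (u v x y : G) (R : ray G) (w : end_of G).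

Lemma linked_notl X u v : linked X u v -> ~ X u.
Proof. by move=> [p [<- _ h]]; apply: h; rewrite inE eqxx. Qed.

Lemma linked_notr X u v : linked X u v -> ~ X v.
Proof. by move=> /linked_sym /linked_notl. Qed.

Lemma linked_adj X u v : adj u v -> ~ X u -> ~ X v -> linked X u v.
Proof.
move=> uv Xu Xv; apply/linkedP; exists [:: v]; split=> //=; first by rewrite uv.
by move=> x; rewrite !inE => /orP[] /eqP ->.
Qed.

Lemma component_linked X C u v : component X C -> C u -> C v <-> linked X u v.
Proof.
move=> [c Xc ->] /= cu; split=> [cv|]; last exact: linked_trans.
by apply: linked_trans cv; exact: linked_sym.
Qed.

Lemma component_disj X C x : component X C -> C x -> ~ X x.
Proof. by move=> [c _ ->]; exact: linked_notr. Qed.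

Lemma component_eq X C D x : component X C -> component X D -> C x -> D x ->
  C = D.
Proof.
move=> cC cD Cx Dx; apply/seteqP; split=> y.
  by move/(component_linked y cC Cx)/(component_linked y cD Dx).
by move/(component_linked y cD Dx)/(component_linked y cC Cx).
Qed.

Lemma component_adj X C u v : component X C -> C u -> adj u v -> ~ X v -> C v.
Proof.
move=> cC Cu uv Xv; apply/(component_linked v cC Cu); apply: linked_adj => //.
exact: component_disj Cu.
Qed.

Lemma linked_mem X (p : fpath G) x :
  (forall y, y \in pverts p -> ~ X y) -> x \in pverts p ->
  linked X (pfirst p) x.
Proof.
case: p => a s aus; rewrite /pverts /= => Xs.
rewrite inE => /orP[/eqP->|xs]; first by
  apply: linked_refl; apply: Xs; rewrite inE eqxx.
have /andP[ps _] := aus; apply/linkedP.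
case/path.splitP: {s aus} xs ps Xs => p1 p2.
rewrite cat_path => /andP[p1P _] Xs.
exists (rcons p1 x); split=> //; first by rewrite last_rcons.
by move=> y yp; apply: Xs; rewrite -cat_cons mem_cat yp.
Qed.

(** To be linked outside the complement of [C] is to be joined inside [C]. Every vertex of the path
    is linked to [u] outside [X], hence lies in [C]. *)
Lemma linked_in_component X C u v : component X C -> C u -> linked X u v ->
  linked (~` C) u v.
Proof.
move=> cC Cu [p [pu pv Xp]]; exists p; split=> // x xp; apply.
by apply/(component_linked x cC Cu); rewrite -pu; exact: linked_mem.
Qed.

Lemma component_sub X Z C D x : component Z C -> C `&` X = set0 ->
  component X D -> C x -> D x -> C `<=` D.
Proof.
move=> cC CX cD Cx Dx y /(component_linked y cC Cx) xy.
apply/(component_linked y cD Dx).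
apply: linked_sub (linked_in_component cC Cx xy) => z Xz Cz.
by have : (C `&` X) z by []; rewrite CX.
Qed.

(** A shortest connection will do: a second vertex in [A] or in [B] would allow a shorter one. *)
Lemma ABpath_exists X (A B : set G) a b : A a -> B b -> linked X a b ->
  exists p : fpath G, ABpath A B p /\ forall x, x \in pverts p -> ~ X x.
Proof.
move=> Aa Bb [p0 [p0a p0b Xp0]].
pose Q n := `[< exists p : fpath G, [/\ A (pfirst p), B (plast p),
  size (prest p) = n & forall x, x \in pverts p -> ~ X x] >].
have exQ : exists n, Q n.
  by exists (size (prest p0)); apply/asboolP; exists p0; rewrite p0a p0b.
case: (ex_minnP exQ) => n /asboolP[p [Ap Bp pn Xp]] minn.
(* Subpaths of [p] avoid [X] automatically, so [p] is at most as long as any of them that joins [A]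
   to [B]. *)
have {}minn q : A (pfirst q) -> B (plast q) ->
    {subset pverts q <= pverts p} -> (size (prest p) <= size (prest q))%N.
  move=> Aq Bq qp; rewrite pn; apply: minn; apply/asboolP; exists q.
  by split=> // x /qp /Xp.
exists p; split=> //; split; apply/seteqP; split=> x /=.
- move=> [+ Ax]; case: p Ap Bp minn {pn Xp} => a' s aus.
  rewrite /pverts /plast /= => Aa' Bs minn.
  rewrite inE => /orP[/eqP//|xs]; have /andP[] := aus.
  case/splitPr: {aus} xs Bs minn => p1 p2 Bs minn.
  rewrite cat_path => /andP[_ /= /andP[_ xp2]] /andP[_].
  rewrite cat_uniq => /and3P[_ _ up2].
  have h : path (@adj G) x p2 && uniq (x :: p2) by apply/andP.
  have := minn (FPath h) Ax; rewrite /pverts /plast /= last_cat /= in Bs *.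
  rewrite size_cat /= => /(_ Bs) /=.
  have sub : {subset x :: p2 <= a' :: p1 ++ x :: p2}.
    by move=> y yp; rewrite inE mem_cat yp !orbT.
  by move=> /(_ sub); rewrite addnS ltnNge leq_addl.
- by move=> ->; split=> //; rewrite inE eqxx.
- move=> [+ Bx]; case: p Ap Bp minn {pn Xp} => a' s aus.
  rewrite /pverts /plast /= => Aa' Bs minn.
  rewrite inE => /orP[/eqP xa|xs].
    have h : path (@adj G) a' [::] && uniq [:: a'] by [].
    have := minn (FPath h) Aa'; rewrite /plast /= -xa => /(_ Bx).
    have sub : {subset [:: x] <= x :: s} by move=> y; rewrite !inE => ->.
    by rewrite /pverts /= => /(_ sub); rewrite leqn0 => /nilP ->.
  have /andP[] := aus.
  case/splitPr: {aus} xs Bs minn => p1 p2 Bs minn.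
  rewrite -cat_rcons cat_path => /andP[xp1 _] up.
  have {up} : uniq ((a' :: rcons p1 x) ++ p2) by [].
  rewrite cat_uniq => /andP[up1 _].
  have h : path (@adj G) a' (rcons p1 x) && uniq (a' :: rcons p1 x).
    exact/andP.
  have := minn (FPath h) Aa'; rewrite /pverts /plast /= last_rcons => /(_ Bx).
  have sub : {subset a' :: rcons p1 x <= a' :: p1 ++ x :: p2}.
    by move=> y; rewrite -cat_rcons -[in X in _ -> X]cat_cons mem_cat => ->.
  move=> /(_ sub); rewrite size_cat size_rcons /= addnS ltnS -[leqRHS]addn0.
  by rewrite leq_add2l leqn0 => /nilP ->; rewrite last_cat last_rcons.
- by move=> ->; split=> //; exact: mem_last.
Qed.

Lemma end_ray_tail X w C R : endcomp X w C -> w R ->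
  exists n, forall m, (n <= m)%N -> C (R m).
Proof. by move=> [_]; exact. Qed.

Lemma endcomp_ray X w C R : finite_set X -> component X C -> w R ->
  (forall n, exists2 m, (n <= m)%N & C (R m)) -> endcomp X w C.
Proof.
move=> finX cC wR RC; have [D wD] := endcomp_exists w finX.
have [n nD] := end_ray_tail wD wR; have [m nm Cm] := RC n.
by rewrite (component_eq cC wD.1 Cm (nD _ nm)).
Qed.

(** A fixed ray of [w] has a tail in each [C], hence is joined to [R] outside [X]; so no finite set
    separates the two rays. *)
Lemma end_rayP w R : (forall X, finite_set X ->
  exists C, endcomp X w C /\ exists n, C (R n)) -> w R.
Proof.
move=> h; have [R0 wE] := endP w.
have wR0 : w R0 by rewrite wE; exact: ray_equiv_refl.
rewrite wE => -[X finX sepX]; have [C [wC [n Cn]]] := h X finX.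
have [k kC] := end_ray_tail wC wR0.
have kn : linked X (R0 k) (R n).
  by apply/(component_linked _ wC.1) => //; exact: kC.
have [p [Ap Xp]] := ABpath_exists (imageT R0 k) (imageT R n) kn.
by have [x /Xp] := sepX p Ap.
Qed.

(** A common ray forces C(X, w) = C(X, w') for every finite [X], so [end_rayP] gives the same rays;
    proof irrelevance does the rest. *)
Lemma end_eq w w' R : w R -> w' R -> w = w'.
Proof.
have sub (v v' : end_of G) : v R -> v' R -> rays_of v `<=` rays_of v'.
  move=> vR v'R Q vQ; apply: end_rayP => X finX.
  have [C v'C] := endcomp_exists v' finX; exists C; split=> //.
  have vC : endcomp X v C.
    apply: endcomp_ray finX v'C.1 vR _ => n.
    have [m mC] := end_ray_tail v'C v'R.
    by exists (maxn n m); [exact: leq_maxl|apply: mC; exact: leq_maxr].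
  by have [m mC] := end_ray_tail vC vQ; exists m; exact: mC.
move=> wR w'R; have : rays_of w = rays_of w'.
  by apply/seteqP; split; exact: sub.
case: w w' {wR w'R} => r rP [r' r'P] /= E; case: _ / E r'P => r'P.
by rewrite (Prop_irrelevance rP r'P).
Qed.

(** Otherwise [end_rayP] would make a ray of [w'] a ray of [w]. *)
Lemma end_separator w w' : w <> w' -> exists X C,
  [/\ finite_set X, endcomp X w C & ~ endcomp X w' C].
Proof.
move=> ww'; apply: contrapT => h; apply: ww'.
have [R w'R] := end_nonempty w'; apply: (end_eq (R := R)) => //.
apply: end_rayP => X finX; have [C wC] := endcomp_exists w finX.
exists C; split=> //; have : endcomp X w' C.
  by apply: contrapT => nC; apply: h; exists X, C.
by move=> /end_ray_tail /(_ w'R)[n h']; exists n; exact: h'.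
Qed.

Definition ray_drop R (k : nat) : ray G.
Proof.
exists (fun n => R (k + n)%N) => [n m /ray_inj /addnI//|n].
by rewrite addnS; exact: ray_adj.
Defined.

Lemma end_ray_shift w R R' k m : (forall n, R' (k + n)%N = R (m + n)%N) ->
  w R -> w R'.
Proof.
move=> E wR; apply: end_rayP => X finX.
have [C wC] := endcomp_exists w finX; exists C; split=> //.
have [n nC] := end_ray_tail wC wR; exists (k + n)%N; rewrite E.
by apply: nC; exact: leq_addl.
Qed.

Lemma end_ray_drop w R k : w R -> w (ray_drop R k).
Proof. exact: (@end_ray_shift w R (ray_drop R k) 0 k). Qed.

Lemma nbhs_endP w (U : set (end_of G)) : nbhs w U <-> exists X C,
  [/\ finite_set X, endcomp X w C & Omega X C `<=` U].
Proof.
rewrite nbhsE; split.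
  move=> [O [[DO sDO <-] [B DB Bw]] OU].
  have [X [C [finX cC EB]]] := sDO _ DB.
  exists X, C; split=> //; first by move: Bw; rewrite /= EB.
  by move=> w' w'C; apply: OU; exists B => //; rewrite /= EB.
move=> [X [C [finX wC CU]]]; exists (Omega X C) => //; split=> //.
exists [set Omega X C]; last by rewrite bigcup_set1.
by move=> _ ->; exists X, C; split=> //; case: wC.
Qed.

Lemma ABpath_first (A B : set G) (p : fpath G) : ABpath A B p -> A (pfirst p).
Proof.
by move=> [pA _]; have : [set pfirst p] (pfirst p) by []; rewrite -pA => -[].
Qed.

Lemma ABpath_last (A B : set G) (p : fpath G) : ABpath A B p -> B (plast p).
Proof.
by move=> [_ pB]; have : [set plast p] (plast p) by []; rewrite -pB => -[].
Qed.

Lemma fpath_eq (p q : fpath G) : pfirst p = pfirst q -> prest p = prest q ->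
  p = q.
Proof.
case: p q => a s aus [b t bvt] /= ab st; rewrite ab st in aus *.
by rewrite (bool_irrelevance aus bvt).
Qed.

Lemma fpath_closed (p : fpath G) : plast p = pfirst p -> prest p = [::].
Proof.
rewrite /plast; case: p => a s /=; case: (lastP s) => // s' b aus.
by rewrite last_rcons => ab; move: aus; rewrite ab /= mem_rcons inE eqxx andbF.
Qed.

(** With [v] on [R], every path of the fan would be the trivial one at [v]. *)
Lemma fan_nontrivial v R (F : set (fpath G)) : infinite_set F ->
  (forall p, F p -> ABpath [set v] (range R) p) -> ~ range R v.
Proof.
move=> infF Fp vR; apply: infF.
have Fv p : F p -> pfirst p = v /\ prest p = [::].
  move=> /Fp pv; have pfv : pfirst p = v by exact: (ABpath_first pv).
  split=> //; apply: fpath_closed.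
  have : ([set x | x \in pverts p] `&` range R) v.
    by split=> //=; rewrite inE pfv eqxx.
  by rewrite pv.2 /= => <-.
have [->//|/set0P[p0 Fp0]] := eqVneq F set0.
apply: (sub_finite_set _ (finite_set1 p0)) => p FpF /=.
have [pv pn] := Fv p FpF; have [p0v p0n] := Fv p0 Fp0.
by apply: fpath_eq; rewrite ?pv ?pn.
Qed.

(** A vertex other than [v] lies on at most one path of the fan, so some path avoids [X] and leads
    from [v] to a tail of [R] inside [C]. *)
Lemma dominates_endcomp v w X C : dominates v w -> finite_set X -> ~ X v ->
  endcomp X w C -> C v.
Proof.
move=> [R wR [F [infF Fp Fd]]] finX Xv wC.
have [n nC] := end_ray_tail wC wR.
have vR := fan_nontrivial infF Fp.
(* The first [n] vertices of [R] are blocked too, so that the path found ends in the tail of [R]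
   inside [C]. *)
pose Y := X `|` R @` `I_n.
have Yv : ~ Y v by move=> [//|[k _ Rk]]; apply: vR; exists k.
have finY : finite_set Y.
  by rewrite /Y finite_setU; split=> //; apply: finite_image; exact: finite_II.
pose Bad := \bigcup_(y in Y) [set p | F p /\ y \in pverts p].
have finBad : finite_set Bad.
  apply: bigcup_finite => // y Yy.
  have [->//|/set0P[p0 [Fp0 yp0]]] :=
    eqVneq [set p | F p /\ y \in pverts p] set0.
  apply: (sub_finite_set _ (finite_set1 p0)) => p [FpF yp] /=.
  apply: contrapT => pp0; apply: Yv.
  by rewrite -(Fd p p0 FpF Fp0 pp0 y yp yp0).
have [p [FpF nBad]] := infinite_setN0 (infinite_setD infF finBad).
have Yp y : y \in pverts p -> ~ Y y by move=> yp Yy; apply: nBad; exists y.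
have [m _ Rm] := ABpath_last (Fp p FpF).
have Cm : C (R m).
  apply: nC; rewrite leqNgt; apply/negP => mn; apply: (Yp (R m)).
    by rewrite Rm; exact: mem_last.
  by right; exists m.
apply/(component_linked _ wC.1 Cm); apply: linked_sym.
exists p; split=> //; first exact: ABpath_first (Fp p FpF).
by move=> x /Yp h Xx; apply: h; left.
Qed.

(** A maximal family of paths from [v] to a ray of [w] meeting only in [v] is infinite: otherwise
    its vertices other than [v] form a finite [X], and a further path exists outside [X]. *)
Lemma dominatesP v w : (forall X C, finite_set X -> ~ X v -> endcomp X w C ->
  C v) -> dominates v w.
Proof.
move=> h; have [R0 wR0] := end_nonempty w.
(* Dropping a start of the ray moves [v] off it, as a fan requires. *)
have [n0 R0v] := finite_avoid R0 (finite_set1 v).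
pose R := ray_drop R0 n0; have wR : w R by exact: end_ray_drop.
have vR : ~ range R v.
  by move=> [m _ Rm]; apply: (R0v (n0 + m)%N); rewrite ?leq_addr.
exists R => //.
pose r (p q : fpath G) := forall x, x \in pverts p -> x \in pverts q -> x = v.
have [F [FP Fr Fmax]] :=
  @maximal_pairwise _ (fun p => ABpath [set v] (range R) p) r
    (fun p q pq x xq xp => pq x xp xq).
exists F; split=> // finF.
pose X := (\bigcup_(p in F) [set x | x \in pverts p]) `\ v.
have finX : finite_set X by apply: finite_setD; apply: bigcup_finite.
have Xv : ~ X v by move=> [_]; exact.
have [C wC] := endcomp_exists w finX.
have [n nC] := end_ray_tail wC wR.
have vn : linked X v (R n).
  by apply/(component_linked _ wC.1); [exact: (h X)|exact: nC].
have [p [pv Xp]] := ABpath_exists (erefl v : [set v] v) (imageT R n) vn.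
have lastp : plast p \in pverts p by exact: mem_last.
have nlast q : F q -> plast p \in pverts q -> False.
  move=> Fq pq; apply: (Xp (plast p)) => //; split; first by exists q.
  by move=> pe; apply: vR; rewrite -pe; exact: (ABpath_last pv).
have [q Fq] := Fmax p pv (fun Fp => nlast p Fp lastp).
apply=> x xp xq; apply: contrapT => xv; apply: (Xp x xp).
by split=> //; exists q.
Qed.
End Components.

(** * The envelope of an end *)

Lemma nat_bound (T : Type) (d : T -> nat) (X : set T) : finite_set X ->
  exists n, forall y, X y -> (d y < n)%N.
Proof.
move=> finX; have /finite_seqP[s sE] := finite_image d finX.
exists (\max_(i <- s) i).+1 => y Xy; rewrite ltnS.
have : (d @` X) (d y) by exists y.
by rewrite sE /= => ds; exact: leq_bigmax_seq.
Qed.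

Section Neighbourhoods.
Variable G : graph.
Implicit Types (X Z C D K : set G) (u v x y z : G) (R : ray G) (w : end_of G).

Definition nbhd K : set G := [set v | ~ K v /\ exists2 u, K u & adj u v].

Lemma nbhd_sub Z K : component Z K -> nbhd K `<=` Z.
Proof.
move=> cK v [Kv [u Ku uv]]; apply: contrapT => Zv.
by apply: Kv; exact: component_adj cK Ku uv Zv.
Qed.

Lemma nbhd_sub_component Z K X D : component Z K -> K `&` X = set0 ->
  component X D -> nbhd K `&` D !=set0 -> K `<=` D.
Proof.
move=> cK KX cD [v [[_ [u Ku uv]] Dv]].
apply: (component_sub cK KX cD Ku); apply: (component_adj cD Dv).
  by rewrite adj_sym.
by move=> Xu; have : (K `&` X) u by []; rewrite KX.
Qed.

(* A spanning tree of [K] rooted at [c]: [f] is the parent function and [d] the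
   height. *)
Lemma spanning_tree Z K c : component Z K -> K c ->
  exists (f : G -> G) (d : G -> nat), f c = c /\ forall v, K v -> v <> c ->
    [/\ K (f v), adj (f v) v & (d (f v) < d v)%N].
Proof.
move=> cK Kc.
(* Walks from [c] outside [Z] stay in [K]. For [v] in [K] the least length of such a walk to [v] is
   [d v], and the parent of [v] is its predecessor on a shortest one. *)
pose level n v := exists s, [/\ size s = n, path (@adj G) c s, last c s = v &
  forall x, x \in c :: s -> ~ Z x].
have levelK n v : level n v -> K v.
  move=> [s [_ ps ls Zs]]; apply/(component_linked v cK Kc)/linkedP.
  by exists s.
have : forall v, exists n, K v ->
    level n v /\ forall m, level m v -> (n <= m)%N.
  move=> v; have [Kv|nKv] := pselect (K v); last by exists 0%N.
  have ex : exists n, `[< level n v >].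
    have /linkedP[s [ps ls Zs]] : linked Z c v.
      by apply/(component_linked v cK Kc).
    by exists (size s); apply/asboolP; exists s.
  case: (ex_minnP ex) => n /asboolP nv minn; exists n => _; split=> // m mv.
  by apply: minn; apply/asboolP.
move=> /choice[d dP].
have : forall v, exists u, (v = c -> u = c) /\ (K v -> v <> c ->
    [/\ K u, adj u v & (d u < d v)%N]).
  move=> v; have [->|/eqP vc] := eqVneq v c; first by exists c.
  have [Kv|nKv] := pselect (K v); last by exists c.
  have [[s [sd ps ls Zs]] _] := dP v Kv.
  case: (lastP s) sd ps ls Zs => [_ _ /= cv|s' v' sd]; first by case: vc.
  rewrite rcons_path last_rcons => /andP[ps' uv'] v'E Zs; rewrite v'E in uv'.
  have lu : level (size s') (last c s').
    exists s'; split=> // x; rewrite inE => /orP[xc|xs]; apply: Zs.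
      by rewrite inE xc.
    by rewrite inE mem_rcons inE xs !orbT.
  exists (last c s'); split=> // _ _; split=> //; first exact: levelK lu.
  have [_ /(_ _ lu)] := dP _ (levelK _ _ lu).
  by rewrite -sd size_rcons ltnS.
move=> /choice[f fP]; exists f, d; split; first exact: (fP c).1.
by move=> v; exact: (fP v).2.
Qed.

Definition concentrated Z w := forall X D, finite_set X -> endcomp X w D ->
  finite_set (Z `\` D).

(** * Konig's lemma in a spanning tree *)

Section Konig.
Variables (Z K : set G) (w : end_of G) (c : G) (f : G -> G) (d : G -> nat).
Variable a : G -> G.
Hypotheses (concZ : concentrated Z w) (cK : component Z K) (Kc : K c).
Hypotheses (fc : f c = c) (ftree : forall v, K v -> v <> c ->
    [/\ K (f v), adj (f v) v & (d (f v) < d v)%N]).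
Hypothesis (aK : forall h, nbhd K h -> K (a h) /\ adj (a h) h).

(** The tree order: [x] lies in the subtree rooted at [t], possibly [x = t]. *)
Let above t x := exists k, iter k f x = t.

Let Kf v : K v -> K (f v).
Proof. by move=> Kv; have [->|/eqP/(ftree Kv)[]] := eqVneq v c; rewrite ?fc. Qed.

Let df v : K v -> (d (f v) <= d v)%N.
Proof.
move=> Kv; have [->|/eqP/(ftree Kv)[_ _ /ltnW//]] := eqVneq v c.
by rewrite fc.
Qed.

Let Kiter k v : K v -> K (iter k f v).
Proof. by move=> Kv; elim: k => //= k; exact: Kf. Qed.

Let above_trans t s x : above t s -> above s x -> above t x.
Proof. by move=> [k <-] [l <-]; exists (k + l)%N; rewrite iterD. Qed.

Let above_d t x : K x -> above t x -> (d t <= d x)%N.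
Proof.
move=> Kx [k <-]; elim: k => //= k; apply: leq_trans; apply: df; exact: Kiter.
Qed.

Let above_root x : K x -> above c x.
Proof.
have [n] := ubnP (d x); elim: n x => // n IH x; rewrite ltnS => dx Kx.
have [->|/eqP/(ftree Kx)[Kfx _ dfx]] := eqVneq x c; first by exists 0%N.
have [k kE] := IH (f x) (leq_trans dfx dx) Kfx.
by exists k.+1; rewrite iterSr.
Qed.

Let above_linked X t x : K x -> above t x ->
  (forall y, K y -> above t y -> above y x -> ~ X y) -> linked X x t.
Proof.
move=> Kx [k]; elim: k x Kx => [|k IH] x Kx.
  move=> /= xt; rewrite -xt => h; apply: linked_refl.
  by apply: h => //; exists 0%N.
rewrite iterSr => kt h.
have xf y : above y (f x) -> above y x.
  by move=> [l <-]; exists l.+1; rewrite iterSr.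
have ft : linked X (f x) t.
  by apply: IH => // [|y Ky ty yx]; [exact: Kf|apply: h => //; exact: xf].
(* [f] is stationary at the root, so there the claim is the induction hypothesis. *)
have [xc|/eqP/(ftree Kx)[Kfx fx _]] := eqVneq x c.
  by rewrite xc fc in ft; rewrite xc.
apply: linked_trans ft; apply: linked_adj; first by rewrite adj_sym.
  by apply: h => //; [exists k.+1; rewrite iterSr|exists 0%N].
by apply: h => //; [exists k|exists 1%N].
Qed.

(** Konig's lemma follows subtrees to which [a] attaches infinitely many neighbours of [K]; several
    of these may share one vertex of [K]. *)
Let branch t : set G := [set h | nbhd K h /\ above t (a h)].

(** The condition [s <> t] matters at the root, which is its own parent. *)
Let child t y : above t y -> y <> t ->
  exists s, [/\ f s = t, s <> t & above s y].
Proof.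
move=> [k]; elim: k y => [//|k IH] y; rewrite iterSr => kt yt.
have [fyt|/eqP fyt] := eqVneq (f y) t.
  by exists y; split=> //; exists 0%N.
have [s [fs st sy]] := IH _ kt fyt; exists s; split=> //.
by apply: above_trans sy _; exists 1%N.
Qed.

Let branch_sub s t : above t s -> branch s `<=` branch t.
Proof. by move=> ts h [Nh sh]; split=> //; exact: above_trans ts sh. Qed.

(** The tree need not be locally finite. If the branch of [t] is infinite but that of each child is
    finite, then no finite [X] missing [t] cuts [t] off from C(X, w), so [t] dominates [w]. *)
Let branch_step t : K t -> infinite_set (branch t) -> ~ dominates t w ->
  exists s, [/\ K s, f s = t, s <> t & infinite_set (branch s)].
Proof.
move=> Kt inft ndom; apply: contrapT => nchild; apply: ndom.
have fin y : K y -> above t y -> y <> t -> finite_set (branch y).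
  move=> Ky ty yt; have [s [fs st [k sE]]] := child ty yt.
  apply: contrapT => infy; apply: nchild; exists s; split=> //.
    by rewrite -sE; exact: Kiter.
  by apply: sub_infinite_set infy; apply: branch_sub; exists k.
(* [X] meets only finitely many of the branches above [t], and each of them
   carries only finitely many neighbours of [K]. *)
apply: dominatesP => X D finX Xt wD.
pose Bad := Z `\` D `|`
  \bigcup_(y in X `&` [set y | K y /\ above t y]) branch y.
have finBad : finite_set Bad.
  rewrite /Bad finite_setU; split; first exact: concZ finX wD.
  apply: bigcup_finite; first exact: finite_setIl.
  by move=> y [Xy [Ky ty]]; apply: fin => // yt; apply: Xt; rewrite -yt.
have [h [[Nh th] nBad]] := infinite_setN0 (infinite_setD inft finBad).
have [Kah ah] := aK Nh.
have Dh : D h.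
  apply: contrapT => nD; apply: nBad; left; split=> //; exact: nbhd_sub cK _ Nh.
apply/(component_linked _ wD.1 Dh).
have l : linked X (a h) t.
  apply: above_linked => // y Ky ty yh Xy; apply: nBad; right.
  by exists y => //; split.
apply: (linked_trans _ l); apply: linked_adj; first by rewrite adj_sym.
  exact: component_disj wD.1 Dh.
exact: linked_notl l.
Qed.

(** Repeating [branch_step] from the root gives a ray. Infinitely many neighbours of [K] are
    attached above each of its vertices, all but finitely many of them in C(X, w); far enough out, a
    tree path outside [X] joins one of these to the ray. *)
Lemma konig_ray : infinite_set (nbhd K) ->
  (forall t, K t -> ~ dominates t w) ->
  exists R, w R /\ forall n, K (R n).
Proof.
move=> infN ndom.
have : forall t, exists s, K t -> infinite_set (branch t) ->
    [/\ K s, f s = t, s <> t & infinite_set (branch s)].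
  move=> t; have [[Kt inft]|h] := pselect (K t /\ infinite_set (branch t)).
    by have [s sP] := branch_step Kt inft (ndom t Kt); exists s.
  by exists t => Kt inft; case: h.
move=> /choice[g gP].
pose t n := iter n g c.
have tP n : K (t n) /\ infinite_set (branch (t n)).
  elim: n => [|n [Kt inft]]; last by have [] := gP _ Kt inft.
  split=> //; apply: sub_infinite_set infN => h Nh; split=> //.
  by apply: above_root; case: (aK Nh).
have step n : adj (t n) (t n.+1) /\ (d (t n) < d (t n.+1))%N.
  have [Kt inft] := tP n; have [Kg fg gt _] := gP _ Kt inft.
  (* The root is its own parent, so [t n.+1 = c] would give [t n.+1 = t n]. *)
  have gc : t n.+1 <> c by move=> E; apply: gt; rewrite -[LHS]/(t n.+1) E -fc -E.
  by have [_] := ftree Kg gc; rewrite fg.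
have dmono : {homo (d \o t) : i j / (i < j)%N >-> (i < j)%N}.
  by apply: homo_ltn => [? ? ?|i]; [exact: ltn_trans|exact: (step i).2].
have tinj : injective t.
  move=> i j tij; case: (ltngtP i j) => // /dmono /=; by rewrite tij ltnn.
exists (Ray tinj (fun n => (step n).1)); split; last by move=> n; exact: (tP n).1.
apply: end_rayP => X finX; have [D wD] := endcomp_exists w finX.
exists D; split=> //; have [n Xn] := nat_bound d finX; exists n => /=.
(* By their height, no vertices of [X] lie above [t n]. *)
have dn : (n <= d (t n))%N.
  by elim: n {Xn} => // n IH; exact: leq_ltn_trans IH (step n).2.
have [Kt inft] := tP n.
have [h [[Nh th] nZ]] := infinite_setN0 (infinite_setD inft (concZ finX wD)).
have [Kah ah] := aK Nh.
have Dh : D h.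
  by apply: contrapT => nD; apply: nZ; split=> //; exact: nbhd_sub cK _ Nh.
apply/(component_linked _ wD.1 Dh).
have l : linked X (a h) (t n).
  apply: above_linked => // y Ky ty _ Xy.
  have := leq_ltn_trans (leq_trans dn (above_d Ky ty)) (Xn y Xy).
  by rewrite ltnn.
apply: (linked_trans _ l); apply: linked_adj; first by rewrite adj_sym.
  exact: component_disj wD.1 Dh.
exact: linked_notl l.
Qed.

End Konig.

Lemma infinite_nbhd Z K w : concentrated Z w -> component Z K ->
  infinite_set (nbhd K) ->
  (exists2 t, K t & dominates t w) \/ exists R, w R /\ forall n, K (R n).
Proof.
move=> concZ cK infN.
have [[t [Kt dt]]|ndom] := pselect (exists t, K t /\ dominates t w).
  by left; exists t.
right; have [h0 [_ [c Kc _]]] := infinite_setN0 infN.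
have [f [d [fc ft]]] := spanning_tree cK Kc.
have : forall h, exists u, nbhd K h -> K u /\ adj u h.
  move=> h; have [[Kh [u Ku uh]]|nN] := pselect (nbhd K h); first by exists u.
  by exists h.
move=> /choice[a aK].
apply: (konig_ray concZ cK Kc fc ft aK infN) => t Kt dt.
by apply: ndom; exists t.
Qed.

(** Maximality of [F] makes every ray of [w] meet [Z]. Only finitely many rays of [F] meet [X], each
    with a tail in [D]; the other rays lie in [D], as do the dominating vertices outside [X]. *)
Lemma envelope w : exists F : set (ray G),
  [/\ F `<=` w, forall R R', F R -> F R' -> R <> R' ->
        range R `&` range R' = set0 &
      let Z := [set v | dominates v w] `|` \bigcup_(R in F) range R in
      concentrated Z w /\ forall R, w R -> exists n, Z (R n)].
Proof.
pose r (R R' : ray G) := range R `&` range R' = set0.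
have r_sym R R' : r R R' -> r R' R by rewrite /r setIC.
have [F [Fw Fr Fmax]] := maximal_pairwise w r_sym.
exists F; split=> // Z; split; last first.
  move=> R wR; have [FR|nFR] := pselect (F R).
    by exists 0%N; right; exists R.
  have [R' FR' /eqP/set0P[_ [[n _ <-] R'n]]] := Fmax R wR nFR.
  by exists n; right; exists R'.
move=> X D finX wD.
(* Disjointness leaves at most one ray of [F] through [x], and this ray has only finitely many
   vertices outside [D]. *)
pose B x := \bigcup_(R in [set R | F R /\ range R x]) (range R `\` D).
have finB x : finite_set (B x).
  have [[R [FR Rx]]|nR] := pselect (exists R, F R /\ range R x); last first.
    rewrite (_ : B x = set0) //; apply/seteqP; split=> // y [R [FR Rx] _].
    by apply: nR; exists R.
  have [n nD] := end_ray_tail wD (Fw _ FR).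
  apply: (sub_finite_set _ (finite_image R (finite_II n))).
  move=> y [R' [FR' R'x] [[m _ <-] nDm]].
  have E : R' = R.
    apply: contrapT => /(Fr _ _ FR' FR) E.
    by have : (range R' `&` range R) x by []; rewrite E.
  rewrite E in nDm *; exists m => //=; rewrite ltnNge; apply/negP => /nD.
  exact: nDm.
apply: (@sub_finite_set _ _ (X `|` \bigcup_(x in X) B x)); last first.
  by rewrite finite_setU; split=> //; exact: bigcup_finite.
move=> v [[dv|[R FR [k _ kv]]] nDv].
  left; apply: contrapT => Xv; apply: nDv.
  exact: dominates_endcomp dv finX Xv wD.
have [[x Xx Rx]|nX] := pselect (exists2 x, X x & range R x).
  by right; exists x => //; exists R => //; split=> //; exists k.
case: nDv; have [n nD] := end_ray_tail wD (Fw _ FR).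
have RX m : ~ X (R m) by move=> XRm; apply: nX; exists (R m) => //; exists m.
have Dm : D (R (maxn k n)) by apply: nD; exact: leq_maxr.
rewrite -kv; apply/(component_linked _ wD.1 Dm); apply: linked_sym.
by apply: linked_tail => [? _|]; [exact: RX|exact: leq_maxl].
Qed.

(** Both outcomes of [infinite_nbhd] would put a vertex of [Z] into [K]. *)
Lemma envelope_nbhd Z K w : concentrated Z w ->
  [set v | dominates v w] `<=` Z -> (forall R, w R -> exists n, Z (R n)) ->
  component Z K -> finite_set (nbhd K).
Proof.
move=> concZ domZ rayZ cK; apply: contrapT => infN.
have [[t Kt dt]|[R [wR KR]]] := infinite_nbhd concZ cK infN.
  exact: component_disj cK Kt (domZ _ dt).
by have [n Zn] := rayZ R wR; exact: component_disj cK (KR n) Zn.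
Qed.

(** No walk leaves [K] without meeting [nbhd K]. Once [nbhd K] is finite, it can thus replace the
    possibly infinite [Z] as a separator. *)
Lemma component_nbhd Z K : component Z K -> component (nbhd K) K.
Proof.
move=> cK; have [u Zu KE] := cK.
have Ku : K u by rewrite KE; exact: linked_refl.
exists u; first by case.
apply/seteqP; split=> v /=.
  move=> Kv; apply: (@linked_sub _ _ (~` K)) => [y []//|].
  by apply: (linked_in_component cK Ku); apply/(component_linked v cK Ku).
move=> /linkedP[s [ps <- Ns]]; elim: s u Ku ps Ns {Zu KE} => //= x s IH u Ku.
move=> /andP[ux ps] Ns; apply: IH => // [|y ys]; last first.
  by apply: Ns; rewrite inE ys orbT.
apply: contrapT => nKx; apply: (Ns x); first by rewrite !inE eqxx orbT.
by split=> //; exists u.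
Qed.

(** Some finite [X] separates [w'] from [w]. As only finitely many vertices of [Z] lie outside C(X,
    w), a ray of [w'] has a tail avoiding [Z], and [K] is the component containing that tail. *)
Lemma concentrated_end Z w w' : concentrated Z w ->
  (forall K, component Z K -> finite_set (nbhd K)) -> w' <> w ->
  exists2 K, component Z K & endcomp (nbhd K) w' K.
Proof.
move=> concZ finN ww'; have [R w'R] := end_nonempty w'.
have [X [D [finX wD nw'D]]] := end_separator (nesym ww').
have [D' w'D'] := endcomp_exists w' finX.
have [n nD'] := end_ray_tail w'D' w'R.
have [n' Zn'] := finite_avoid R (concZ X D finX wD).
have ZR m : (maxn n n' <= m)%N -> ~ Z (R m).
  rewrite geq_max => /andP[nm n'm] Zm.
  apply: (Zn' m n'm); split=> // Dm; apply: nw'D.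
  by rewrite (component_eq wD.1 w'D'.1 Dm (nD' _ nm)).
pose K : set G := [set v | linked Z (R (maxn n n')) v].
have cK : component Z K by exists (R (maxn n n')) => //; exact: ZR.
exists K => //; apply: endcomp_ray (finN K cK) (component_nbhd cK) w'R _ => k.
exists (maxn k (maxn n n')); first exact: leq_maxl.
by apply: linked_tail => //; exact: leq_maxr.
Qed.
End Neighbourhoods.

(** * Suns and star-decompositions *)

Section Suns.
Variable G : graph.
Implicit Types (X Z C K : set G) (h u v x y : G) (R Q : ray G) (w : end_of G).

Lemma dray_linked X (D : dray G) (k l : int) : range D `&` X = set0 ->
  linked X (D k) (D l).
Proof.
move=> DX; have XD j : ~ X (D j).
  move=> Xj; have : (range D `&` X) (D j) by split=> //; exists j.
  by rewrite DX.
suff h j : linked X (D 0%R) (D j).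
  exact: linked_trans (linked_sym (h k)) (h l).
have step i : linked X (D i) (D (i + 1)%R).
  by apply: linked_adj => //; exact: dray_adj.
case: j => n.
  elim: n => [|n IH]; first exact: linked_refl.
  by apply: linked_trans IH _; rewrite -addn1 PoszD.
rewrite NegzE; elim: n.+1 => [|{}n IH].
  by rewrite oppr0; exact: linked_refl.
apply: linked_trans IH (linked_sym _).
by rewrite -[X in linked _ _ (D X)](addrNK 1%R) -opprD -PoszD addn1.
Qed.

Lemma dray_tail_mem (D : dray G) R : dray_tail D R ->
  forall n, exists k, R n = D k.
Proof.
by move=> [k [E|E]] n; rewrite E; [exists (k + n%:Z)%R|exists (k - n%:Z)%R].
Qed.

(** [P i] is connected outside [X] and meets [C], either in its tail belonging to [w] or in its
    first vertex, which dominates [w]. So all of it lies in [C], including a ray of [wi i]. *)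
Lemma sun_avoid_endcomp (I : Type) w (P : I -> gcarrier G) wi i X C :
  sun w P wi -> finite_set X -> gverts (P i) `&` X = set0 -> endcomp X w C ->
  endcomp X (wi i) C.
Proof.
move=> [[Pgen _ _] Pkind] finX PX wC.
have [R wiR RC] : exists2 R, wi i R & forall n, C (R n).
  case: Pkind => [/(_ i)[D PD]|/(_ i)[R [PR wiR dR]]].
    have := Pgen i; rewrite PD /= => -[_ [R1 [R2 [t1 t2 wR1 wiR2]]]].
    rewrite PD /= in PX.
    exists R2 => // n; have [m mC] := end_ray_tail wC wR1.
    apply/(component_linked _ wC.1 (mC m (leqnn m))).
    have [k1 ->] := dray_tail_mem t1 m; have [k2 ->] := dray_tail_mem t2 n.
    exact: dray_linked.
  rewrite PR /= in PX.
  have XR n : ~ X (R n).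
    by move=> Xn; have : (range R `&` X) (R n) by []; rewrite PX.
  exists R => // n; have C0 := dominates_endcomp dR finX (XR 0%N) wC.
  apply/(component_linked _ wC.1 C0).
  by apply: linked_tail => // ? _; exact: XR.
by apply: endcomp_ray finX wC.1 wiR _ => n; exists n.
Qed.

Lemma uncountable_sun_not_first_countable (I : Type) w
    (P : I -> gcarrier G) wi :
  uncountable_sun w P wi -> ~ first_countable_at w.
Proof.
move=> [sunP uncI] [B [cB Bw Bbase]].
have : forall W : set (end_of G), exists XC : set G * set G, B W ->
    [/\ finite_set XC.1, endcomp XC.1 w XC.2 & Omega XC.1 XC.2 `<=` W].
  move=> W; have [BW|nBW] := pselect (B W); last by exists (set0, set0).
  by have [X [C h]] := (nbhs_endP w W).1 (Bw _ BW); exists (X, C).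
move=> /choice[XC XCP].
pose X := \bigcup_(W in B) (XC W).1.
have cX : countable X.
  apply: bigcup_countable => // W BW; apply: finite_set_countable.
  by have [] := XCP W BW.
have [Pgen Pdisj _] := sunP.1.
(* The paths are disjoint, so each vertex of the countable [X] lies on at most one of them. *)
apply: uncI; pose hit x := [set i | gverts (P i) x].
apply: (@sub_countable _ _ _ (\bigcup_(x in X) hit x)); last first.
  apply: bigcup_countable => // x _; apply: finite_set_countable.
  have [->|/set0P[i0 hi0]] := eqVneq (hit x) set0; first exact: finite_set0.
  apply: (sub_finite_set _ (finite_set1 i0)) => i hi /=.
  apply: contrapT => ii0; have : (gverts (P i) `&` gverts (P i0)) x by split.
  by rewrite Pdisj.
apply: subset_card_le => i _; apply: contrapT => nhit.
(* [P i] avoids all chosen separators, so [wi i] lies in every member of [B], although some finite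
   [Y] separates it from [w]. *)
have [Y [C [finY wC nwiC]]] := end_separator (Pgen i).1.
have [W BW WC] : exists2 W, B W & W `<=` Omega Y C.
  by apply: Bbase; apply/nbhs_endP; exists Y, C; split.
have [finXW wXC sub] := XCP W BW.
apply: nwiC; apply: WC; apply: sub; apply: sun_avoid_endcomp sunP finXW _ wXC.
rewrite -subset0 => x [Pix XWx]; apply: nhit.
by exists x => //; exists W.
Qed.

(** [Q] is the path continued by the tail of [R] from its last vertex [R m], with [k] the length of
    the path. Injectivity holds because the path meets [R] only there. *)
Lemma path_ray h R (p : fpath G) : ABpath [set h] (range R) p ->
  exists Q k m, [/\ Q 0%N = h, forall n, Q (k + n)%N = R (m + n)%N &
    forall n, Q n \in pverts p \/ range R (Q n)].
Proof.
move=> hp; have ph : pfirst p = h by exact: (ABpath_first hp).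
have [m _ Rm] := ABpath_last hp.
have [pp up] := andP (fpathP p).
pose s := pverts p; pose k := size (prest p).
pose q n := if (n <= k)%N then nth h s n else R (m + (n - k))%N.
have sk n : (n <= k)%N -> nth h s n \in s by move=> nk; exact: mem_nth.
have qk n : q (k + n)%N = R (m + n)%N.
  rewrite /q; case: n => [|n]; last first.
    by rewrite leqNgt addnS ltnS leq_addr /= subSn ?leq_addr // addKn.
  by rewrite !addn0 leqnn Rm /plast (last_nth h).
have qgt n : (k < n)%N -> q n = R (m + (n - k))%N.
  by move=> kn; rewrite /q leqNgt kn.
have qle n : (n <= k)%N -> q n = nth h s n by rewrite /q => ->.
have mixed i j : (i <= k)%N -> (k < j)%N -> q i <> q j.
  move=> ik kj qij.
  have : ([set x | x \in pverts p] `&` range R) (q i).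
    by split; [rewrite /= qle //; exact: sk|rewrite qij qgt //; exact: imageT].
  rewrite hp.2 /= qij qgt // -Rm => /ray_inj/eqP.
  by rewrite -[eqbRHS]addn0 eqn_add2l subn_eq0 leqNgt kj.
have q_inj : injective q.
  move=> i j; case: (leqP i k) => ik; case: (leqP j k) => jk qij.
  - by move/eqP: qij; rewrite !qle // nth_uniq // => /eqP.
  - by case: (mixed i j).
  - by case: (mixed j i).
  - move: qij; rewrite !qgt // => /ray_inj /addnI /eqP.
    by rewrite eqn_sub2rE 1?ltnW // => /eqP.
have q_adj n : adj (q n) (q n.+1).
  case: (ltnP n k) => nk.
    rewrite (qle _ (ltnW nk)) (qle _ nk).
    by have /(pathP h)/(_ n nk) := pp.
  rewrite -(subnKC nk) -addnS !qk addnS; exact: ray_adj.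
exists (Ray q_inj q_adj), k, m; split=> // n /=.
by rewrite /q; case: leqP => nk; [left; exact: sk|right; exact: imageT].
Qed.

Lemma ray_into_component Z K h w : component Z K -> nbhd K h ->
  endcomp (nbhd K) w K -> exists Q, [/\ Q 0%N = h, forall n, K (Q n.+1) & w Q].
Proof.
move=> cK Nh wK; have [Kh [u Ku uh]] := Nh.
have [R0 wR0] := end_nonempty w; have [n0 KR0] := end_ray_tail wK wR0.
pose R := ray_drop R0 n0; have wR : w R by exact: end_ray_drop.
have KR n : K (R n) by apply: KR0; exact: leq_addr.
(* Avoiding this [X] means staying within [K] and [h]. *)
pose X := ~` (K `|` [set h]).
have hR : linked X h (R 0%N).
  apply: (@linked_trans _ _ _ u).
    apply: linked_adj; first by rewrite adj_sym.
      by move=> nh; apply: nh; right.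
    by move=> nu; apply: nu; left.
  apply: (@linked_sub _ _ (~` K)) => [x nx Kx|]; first by apply: nx; left.
  by apply: (linked_in_component cK Ku); apply/(component_linked _ cK Ku).
have [p [hp Xp]] := ABpath_exists (erefl h : [set h] h) (imageT R 0%N) hR.
have [Q [k [m [Q0 QR Qp]]]] := path_ray hp.
exists Q; split=> // [n|]; last exact: end_ray_shift QR wR.
case: (Qp n.+1) => [/Xp /contrapT[//|]|[j _ <-]]; last exact: KR.
by rewrite -Q0 => /ray_inj.
Qed.

Lemma join_rays (R Q : ray G) : R 0%N = Q 0%N ->
  (forall n m, R n.+1 <> Q m.+1) -> exists D : dray G,
  [/\ dray_tail D R, dray_tail D Q & range D `<=` range R `|` range Q].
Proof.
move=> RQ0 RQ.
have RQS n m : R n <> Q m.+1.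
  by case: n => [|n]; [rewrite RQ0 => /ray_inj|exact: RQ].
(* [Negz n] is -(n + 1), so the negative half starts with [Q 1], and [R 0] stands for the common
   vertex. *)
pose f (k : int) := match k with Posz n => R n | Negz n => Q n.+1 end.
have fN n : f (- n%:Z)%R = Q n.
  by case: n => [|n]; [rewrite oppr0 /= RQ0|rewrite -NegzE].
have f_inj : injective f.
  move=> [i|i] [j|j] /=.
  - by move=> /ray_inj ->.
  - by move=> /RQS.
  - by move=> /esym /RQS.
  - by move=> /ray_inj [->].
have f_adj (k : int) : adj (f k) (f (k + 1)%R).
  case: k => n.
    by rewrite -PoszD addn1; exact: ray_adj.
  rewrite NegzE -addn1 PoszD opprD addrNK -opprD -PoszD addn1 !fN adj_sym.
  exact: ray_adj.
exists (DRay f_inj f_adj); split.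
- by exists 0%R; left=> n; rewrite add0r.
- by exists 0%R; right=> n; rewrite sub0r /= fN.
- by move=> _ [[n|n] _ <-]; [left|right]; exact: imageT.
Qed.

End Suns.

(** * Stars as trees *)

Section Star.
Variable K : choiceType.

Definition star_adj : rel (option K) :=
  fun s t => (s != t) && ((s == None) || (t == None)).

Lemma star_adjE s t : star_adj s t = isSome s (+) isSome t.
Proof. by case: s t => [x|] [y|]; rewrite /star_adj ?eqxx ?andbF. Qed.

Lemma star_adj_sym : symmetric star_adj.
Proof. by move=> s t; rewrite /star_adj eq_sym orbC. Qed.

Lemma star_adj_irr : irreflexive star_adj.
Proof. by move=> s; rewrite /star_adj eqxx. Qed.

Definition star : graph := Graph star_adj_sym star_adj_irr.

(** A path has at most three vertices, and with three the middle one is the centre. Hence the path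
    axiom of a decomposition needs checking at the centre only. *)
Lemma star_path (p : fpath star) t : t \in pverts p ->
  [\/ t = pfirst p, t = plast p | t = None /\ pfirst p <> plast p].
Proof.
case: p => [x [|y [|z s]]] xs; rewrite /pverts /plast /= !inE.
- by move=> /eqP ->; constructor 1.
- by move=> /orP[] /eqP ->; [constructor 1|constructor 2].
have /andP[/= /and3P[xy yz ps]] := xs.
rewrite !inE !negb_or => /and3P[/and3P[_ xnez _] /andP[_ ynes] _].
have [yN sN] : y = None /\ s = [::].
  move: xy yz xnez ynes ps; rewrite /adj /= !star_adjE.
  case: x y z {xs} => [x|] [y|] [z|] //= _ _ _.
  by case: s => [|[u|] s] //=; rewrite star_adjE.
rewrite yN sN /= inE orbF.
move=> /or3P[] /eqP ->; [by constructor 1| |by constructor 2].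
by constructor 3; split=> //; exact/eqP.
Qed.

Lemma star_tree : tree star.
Proof.
split=> [x y|[|a [|b [|c s]]] []//= _].
  have [->|xy] := eqVneq x y; first by exists (@FPath star y [::] isT).
  have [c|nc] := boolP ((x == None) || (y == None)).
    have h : path (@adj star) x [:: y] && uniq [:: x; y].
      by rewrite /= /star_adj xy c inE xy.
    by exists (FPath h).
  have h : path (@adj star) x [:: None; y] && uniq [:: x; None; y].
    by move: nc xy; rewrite /= /star_adj !inE; case: x y => [x|] [y|] //= _ ->.
  by exists (FPath h).
(* Centre and leaves alternate along a cycle, so one of length at least three would repeat the
   centre or join two leaves. *)
rewrite /ucycle /= rcons_path /= => /andP[/and4P[ab bc ps sa]].
rewrite !inE !negb_or => /and3P[/and3P[_ anec _] /andP[_ bnes] _].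
move: ab bc anec bnes ps sa; rewrite !star_adjE.
case: a b c => [a|] [b|] [c|] //= _ _ _.
by case: s => [|[u|] s] //=; rewrite star_adjE.
Qed.

Lemma uncountable_star_star (A : set K) : ~ countable A ->
  @uncountable_star star None.
Proof.
move=> uncA; split=> // cS; apply: uncA.
have cE : countable (Some @` A).
  by apply: sub_countable cS; apply: subset_card_le => _ [h _ <-].
have [f finj] := countable_injP _ cE.
apply/countable_injP; exists (f \o Some) => x y xA yA /= /finj E.
have SA z : z \in A -> Some z \in Some @` A by rewrite !inE => Az; exists z.
by have [] := E (SA x xA) (SA y yA).
Qed.
End Star.

(** * Star-decompositions from components of G - Z *)

Section StarDecomposition.
Variables (G : graph) (w : end_of G) (Z A : set G) (K : G -> set G).
Variable w_ : G -> end_of G.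
Hypothesis rayZ : forall R : ray G, w R -> exists n, Z (R n).
Hypothesis cK : forall h, A h -> component Z (K h).
Hypothesis finN : forall h, A h -> finite_set (nbhd (K h)).
Hypothesis Kinj : forall h h', A h -> A h' -> h <> h' -> K h <> K h'.
Hypothesis w_K : forall h, A h -> endcomp (nbhd (K h)) (w_ h) (K h).

(* The leaves outside [A] get an empty part, so that [A] need not be made into a
   type of tree vertices. *)
Let part (t : star G) : set G :=
  if t is Some h then [set v | A h /\ (K h `|` nbhd (K h)) v]
  else [set v | forall h, A h -> ~ K h v].

Let Z_part : Z `<=` part None.
Proof. by move=> v Zv h /cK /component_disj Kv /Kv. Qed.

Let parts_meet h h' v : h <> h' -> part (Some h) v -> part (Some h') v -> Z v.
Proof.
move=> hh' [Ah [Kv|/(nbhd_sub (cK Ah))//]] [Ah' [Kv'|/(nbhd_sub (cK Ah'))//]].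
by case: (Kinj Ah Ah' hh'); exact: component_eq (cK Ah) (cK Ah') Kv Kv'.
Qed.

(** An edge with an endvertex in some [K h] lies in that leaf part, every other edge in the central
    part. Distinct leaf parts meet inside [Z], hence inside the central part. *)
Lemma star_decomposition : @tree_decomposition G (star G) part.
Proof.
split; first exact: star_tree.
- move=> v; have [h|h] := pselect (part None v); first by exists None.
  have [h' [Ah' Kv]] : exists h', A h' /\ K h' v.
    apply: contrapT => nK; apply: h => h' Ah' Kv; apply: nK.
    by exists h'.
  by exists (Some h'); split=> //; left.
- move=> u v uv.
  have nbr h x y : A h -> K h x -> adj x y ->
      part (Some h) x /\ part (Some h) y.
    move=> Ah Kx xy; split; split=> //; first by left.
    by have [Ky|nKy] := pselect (K h y); [left|right; split=> //; exists x].
  have [[h [Ah Ku]]|nu] := pselect (exists h, A h /\ K h u).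
    by exists (Some h); exact: nbr uv.
  have [[h [Ah Kv]]|nv] := pselect (exists h, A h /\ K h v).
    by exists (Some h); have [] := nbr h v u Ah Kv; rewrite // adj_sym.
  exists None; split=> h Ah Kh; [apply: nu|apply: nv]; by exists h.
- move=> p t /star_path[->|->|[-> xy]] v [] //.
  move: xy; case: (pfirst p) (plast p) => [h|] [h'|] // hh' vh vh'.
  apply: Z_part; apply: parts_meet vh vh' => E; apply: hh'; by rewrite E.
Qed.

Lemma star_finite_adhesion : @finite_adhesion G (star G) part.
Proof.
have fin h : finite_set (part (Some h) `&` part None).
  have [Ah|nAh] := pselect (A h).
    apply: sub_finite_set (finN Ah) => v [[_ [Kv|//]] nK].
    by case: (nK h Ah).
  by rewrite (_ : _ `&` _ = set0) // -subset0 => v [[]].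
move=> s t; rewrite /adj /=.
by rewrite star_adjE; case: s t => [h|] [h'|] // _; rewrite setIC; exact: fin.
Qed.

(** Each tail of a ray of [w] meets [Z], which lies in the central part. *)
Lemma star_lives_centre : @lives_in G (star G) part w None.
Proof.
have [R wR] := end_nonempty w; exists R => // finR.
have [n nR] := finite_avoid R finR.
have [k Zk] := rayZ (end_ray_drop n wR).
apply: (nR (n + k)%N); first exact: leq_addr.
by split; [exact: imageT|exact: Z_part].
Qed.

Lemma star_lives_leaf h : A h -> @lives_in G (star G) part (w_ h) (Some h).
Proof.
move=> Ah; have [R wR] := end_nonempty (w_ h); exists R => // finR.
have [n nR] := finite_avoid R finR.
have [m mK] := end_ray_tail (w_K Ah) wR.
apply: (nR (maxn n m)); first exact: leq_maxl.
split; [exact: imageT|split=> //; left; apply: mK; exact: leq_maxr].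
Qed.

Lemma star_decomposition_exists : ~ countable A ->
  exists (T : graph) (c : T) (V : T -> set G),
    [/\ uncountable_star_decomposition c V, finite_adhesion V,
        lives_in V w c &
        exists leaf : {h | A h} -> T, injective leaf /\
          forall i, leaf i <> c /\ lives_in V (w_ (sval i)) (leaf i)].
Proof.
move=> uncA; exists (star G), None, part; split.
- split; first exact: star_decomposition.
  exact: uncountable_star_star uncA.
- exact: star_finite_adhesion.
- exact: star_lives_centre.
exists (fun i => Some (sval i)); split=> [[h Ah] [h' Ah'] /= [hh']|[h Ah]].
  by case: _ / hh' Ah' => Ah'; rewrite (Prop_irrelevance Ah Ah').
by split=> //; exact: star_lives_leaf.
Qed.

End StarDecomposition.

(** * The dichotomy at an end *)

Lemma sval_inj (T : Type) (A : set T) : injective (@sval T A).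
Proof.
move=> [x Ax] [y Ay] /= xy; case: _ / xy Ay => Ay.
by rewrite (Prop_irrelevance Ax Ay).
Qed.

Section Main.
Variables (G : graph) (w : end_of G) (F : set (ray G)) (Z : set G).
Implicit Types (X K C D : set G) (h v : G) (R Q : ray G).
Hypothesis Fw : F `<=` w.
Hypothesis Fdisj : forall R R', F R -> F R' -> R <> R' ->
  range R `&` range R' = set0.
Hypothesis ZE : Z = [set v | dominates v w] `|` \bigcup_(R in F) range R.
Hypothesis concZ : concentrated Z w.
Hypothesis rayZ : forall R, w R -> exists n, Z (R n).

Let finN K : component Z K -> finite_set (nbhd K).
Proof. by apply: envelope_nbhd concZ _ rayZ; rewrite ZE; left. Qed.

Let w_nsub K X E : component Z K -> endcomp X w E -> ~ (E `<=` K).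
Proof.
move=> cK wE EK; have [R wR] := end_nonempty w.
have [n nE] := end_ray_tail wE wR.
have [k Zk] := rayZ (end_ray_drop n wR).
by apply: (component_disj cK _ Zk); apply: EK; apply: nE; exact: leq_addr.
Qed.

(** [endcomp (nbhd K) w' K] expresses that the end [w'] lives in [K]. Whether [H] is countable
    decides between a countable base and a sun. *)
Let H : set G := [set h | exists K w', [/\ component Z K, nbhd K h &
  endcomp (nbhd K) w' K]].

Lemma first_countable_envelope : countable H -> first_countable_at w.
Proof.
move=> cH.
have NH K w' : component Z K -> endcomp (nbhd K) w' K -> nbhd K `<=` H.
  by move=> cK w'K v Nv; exists K, w'.
have : forall X, exists C, finite_set X -> endcomp X w C.
  move=> X; have [/(endcomp_exists w)[C wC]|nX] := pselect (finite_set X).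
    by exists C.
  by exists set0.
move=> /choice[cw cwP].
exists ((fun X => Omega X (cw X)) @` [set X | X `<=` H /\ finite_set X]).
split.
- apply: sub_countable (card_image_le _ _) _; exact: countable_finite_subset.
- move=> _ [X [_ finX] <-]; apply/nbhs_endP; exists X, (cw X); split=> //.
  exact: cwP.
move=> U /nbhs_endP[Y [D [finY wD DU]]].
pose N y := [set v | exists K w', [/\ component Z K, K y, nbhd K v &
  endcomp (nbhd K) w' K]].
(* With this [X], a component [K] containing an end and with [nbhd K] not inside [X] must miss [Y]
   and have a neighbour in [D]. *)
pose X := H `&` (Z `\` D) `|` \bigcup_(y in Y) N y.
have finX : finite_set X.
  rewrite /X finite_setU; split; first exact: finite_setIr (concZ finY wD).
  apply: bigcup_finite => // y _.
  have [[K [cK Ky]]|nK] := pselect (exists K, component Z K /\ K y).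
    apply: sub_finite_set (finN cK) => v [K' [w' [cK' K'y Nv _]]].
    by rewrite (component_eq cK cK' Ky K'y).
  rewrite (_ : N y = set0) // -subset0 => v [K [w' [cK Ky _ _]]].
  by apply: nK; exists K.
have XH : X `<=` H.
  move=> v [[]//|[y _ [K [w' [cK _ Nv w'K]]]]]; exact: (NH K w').
have XZ : X `<=` Z.
  by move=> v /XH [K [w' [cK Nv _]]]; exact: (nbhd_sub cK Nv).
exists (Omega X (cw X)); first by exists X.
move=> w' w'X; apply: DU; have wX := cwP X finX.
have [->//|/eqP ww'] := eqVneq w' w.
have [K cK w'K] := concentrated_end concZ finN ww'.
(* Otherwise C(X, w'), which equals C(X, w), would lie in [K]. *)
have nNX : ~ (nbhd K `<=` X).
  move=> NX; apply: (w_nsub cK wX).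
  have [R w'R] := end_nonempty w'.
  have [n nX] := end_ray_tail w'X w'R; have [m mK] := end_ray_tail w'K w'R.
  apply: (component_sub w'X.1 _ w'K.1 (nX _ (leq_maxl n m))); last first.
    by apply: mK; exact: leq_maxr.
  by rewrite -subset0 => v [Xv /NX]; exact: (component_disj w'X.1 Xv).
have KY : K `&` Y = set0.
  rewrite -subset0 => y [Ky Yy]; apply: nNX => v Nv; right; exists y => //.
  by exists K, w'.
have ND : nbhd K `&` D !=set0.
  apply/set0P/eqP => ND; apply: nNX => v Nv; left; split; first exact: (NH K w').
  split; first exact: (nbhd_sub cK Nv).
  by move=> Dv; have : (nbhd K `&` D) v by []; rewrite ND.
have KD := nbhd_sub_component cK KY wD.1 ND.
have [R w'R] := end_nonempty w'; have [m mK] := end_ray_tail w'K w'R.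
apply: endcomp_ray finY wD.1 w'R _ => n; exists (maxn n m).
  exact: leq_maxl.
by apply: KD; apply: mK; exact: leq_maxr.
Qed.

Definition strong_sun : Prop :=
  exists (I : Type) (P : I -> gcarrier G) (wi : I -> end_of G)
         (T : graph) (c : T) (V : T -> set G),
    [/\ uncountable_sun w P wi,
        uncountable_star_decomposition c V /\ finite_adhesion V,
        lives_in V w c &
        exists leaf : I -> T,
          injective leaf /\
          forall i, leaf i <> c /\ lives_in V (wi i) (leaf i)].

(** Common to both kinds of sun: [S h] covers what [P h] uses of [Z], namely a ray of the family or
    just [h]. The rest of [P h] lies in [K h], so disjointness follows from that of the [K h] and of
    the [S h]. *)
Lemma strong_sun_intro (A : set G) (K : G -> set G) (w_ : G -> end_of G)
    (P : G -> gcarrier G) (S : G -> set G) : ~ countable A ->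
  (forall h, A h -> component Z (K h)) ->
  (forall h, A h -> endcomp (nbhd (K h)) (w_ h) (K h)) ->
  (forall h h', A h -> A h' -> h <> h' -> K h <> K h') ->
  (forall h, A h -> S h `<=` Z) ->
  (forall h h', A h -> A h' -> h <> h' -> S h `&` S h' = set0) ->
  (forall h, A h -> gverts (P h) `<=` K h `|` S h) ->
  (forall h, A h -> w <> w_ h -> gen_path (P h) w (w_ h)) ->
  (forall h, A h -> exists D : dray G, P h = GDRay D) \/
  (forall h, A h -> exists R,
    [/\ P h = GRay R, w_ h R & dominates (R 0%N) w]) ->
  strong_sun.
Proof.
move=> uncA cK w_K Kinj SZ Sdisj PKS Pgen Pkind.
have finNA h : A h -> finite_set (nbhd (K h)) by move=> /cK /finN.
have [T [c [V [dec adh livc leafs]]]] :=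
  star_decomposition_exists rayZ cK finNA Kinj w_K uncA.
exists {h | A h}, (fun i => P (sval i)), (fun i => w_ (sval i)), T, c, V.
split=> //; split; last first.
  move=> cI; apply: uncA.
  apply: (sub_countable _ (sub_countable (card_image_le (@sval G A) _) cI)).
  by apply: subset_card_le => h Ah; exists (exist _ h Ah).
have sdiff (i j : {h | A h}) : i <> j -> sval i <> sval j.
  by move=> ij /sval_inj.
split; last by case: Pkind => Pk; [left|right] => -[h Ah]; exact: Pk.
split.
(* [w] cannot live in [K h], because its rays keep meeting [Z]. *)
- move=> [h Ah]; apply: Pgen => //= wwh; have := w_K h Ah.
  by rewrite -wwh => /(w_nsub (cK h Ah)); apply.
- move=> i j /sdiff; case: i j => [h Ah] [h' Ah'] /= hh'.
  rewrite -subset0 => v [/(PKS h Ah) hv /(PKS h' Ah') h'v].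
  case: hv h'v => [Kv|Sv] [Kv'|Sv'].
  + case: (Kinj h h' Ah Ah' hh').
    exact: component_eq (cK _ Ah) (cK _ Ah') Kv Kv'.
  + exact: component_disj (cK _ Ah) Kv (SZ _ Ah' _ Sv').
  + exact: component_disj (cK _ Ah') Kv' (SZ _ Ah _ Sv).
  + by rewrite -(Sdisj h h').
- move=> i j E; apply: contrapT => /sdiff.
  case: i j E => [h Ah] [h' Ah'] /= E hh'.
  have [R wR] := end_nonempty (w_ h).
  have [n nK] := end_ray_tail (w_K h Ah) wR; rewrite E in wR.
  have [m mK] := end_ray_tail (w_K h' Ah') wR.
  apply: (Kinj h h' Ah Ah' hh').
  apply: component_eq (cK h Ah) (cK h' Ah') (nK _ (leq_maxl n m)) _.
  by apply: mK; exact: leq_maxr.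
Qed.

Lemma strong_sun_exists : ~ first_countable_at w -> strong_sun.
Proof.
move=> nfc; have uncH : ~ countable H by move/first_countable_envelope.
have [R0 wR0] := end_nonempty w.
have : forall h, exists Kw : set G * end_of G, H h ->
    [/\ component Z Kw.1, nbhd Kw.1 h & endcomp (nbhd Kw.1) Kw.2 Kw.1].
  move=> h; have [[K [w' Kw']]|nH] := pselect (H h); first by exists (K, w').
  by exists (set0, w).
move=> /choice[Kw KwP].
pose K h := (Kw h).1; pose w_ h := (Kw h).2.
have cK h : H h -> component Z (K h) by move=> /KwP[].
have NK h : H h -> nbhd (K h) h by move=> /KwP[].
have w_K h : H h -> endcomp (nbhd (K h)) (w_ h) (K h) by move=> /KwP[].
have HZ : H `<=` Z by move=> h Hh; exact: nbhd_sub (cK h Hh) _ (NK h Hh).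
have : forall h, exists Q, H h ->
    [/\ Q 0%N = h, forall n, K h (Q n.+1) & w_ h Q].
  move=> h; have [Hh|nH] := pselect (H h); last by exists R0.
  by have [Q QP] := ray_into_component (cK h Hh) (NK h Hh) (w_K h Hh); exists Q.
move=> /choice[Q QP].
(* Every such [y] belongs to the finite set [nbhd (K h)]. *)
have conflict_K (A : set G) h : A `<=` H -> A h ->
    countable [set y | A y /\ K y = K h].
  move=> AH Ah; apply: finite_set_countable.
  apply: sub_finite_set (finN (cK h (AH _ Ah))) => y [/AH Hy <-]; exact: NK.
have [cdom|udom] := pselect (countable (H `&` [set v | dominates v w])).
  pose A0 := H `&` \bigcup_(R in F) range R.
  have uncA0 : ~ countable A0.
    move=> cA0; apply: uncH; apply: sub_countable (countable_setU cdom cA0).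
    apply: subset_card_le => h Hh; have := HZ h Hh; rewrite ZE.
    by move=> [?|?]; [left|right].
  have : forall h, exists Rk : ray G * nat, A0 h -> F Rk.1 /\ Rk.1 Rk.2 = h.
    move=> h; have [[_ [R FR [k _ Rk]]]|nA] := pselect (A0 h).
      by exists (R, k).
    by exists (R0, 0%N).
  move=> /choice[Rk RkP]; pose R_ h := (Rk h).1.
  have R_F h : A0 h -> F (R_ h) by move=> /RkP[].
  have [A [AA0 uncA Ar]] : exists A, [/\ A `<=` A0, ~ countable A &
      forall x y, A x -> A y -> x <> y -> K x <> K y /\ R_ x <> R_ y].
    apply: uncountable_pairwise uncA0 _ _.
      by move=> x y [Kxy Rxy]; split; exact: nesym.
    (* A conflict with [x] means sharing its component or lying on its ray; both concern only
       countably many [y]. *)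
    move=> x A0x; apply: (@sub_countable _ _ _
        ([set y | A0 y /\ K y = K x] `|` range (R_ x))); last first.
      apply: countable_setU; first by apply: conflict_K A0x => y [].
      exact: sub_countable (card_image_le _ _) (countableP _).
    apply: subset_card_le => y [A0y nr].
    have [Kxy|Kxy] := pselect (K x = K y); first by left.
    right; have -> : R_ x = R_ y by apply: contrapT => Rxy; apply: nr.
    by have [_ Rky] := RkP y A0y; exists (Rk y).2.
  have AH h : A h -> H h by move=> /AA0[].
  (* [D] follows [Q h] back to [h] and then the tail of [R_ h] from [h]. The two rays meet only in
     [h], as [R_ h] lies in [Z] and the rest of [Q h] in [K h]. *)
  have : forall h, exists P, A h -> exists D : dray G, [/\ P = GDRay D,
      dray_tail D (Q h), dray_tail D (ray_drop (R_ h) (Rk h).2) &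
      range D `<=` K h `|` range (R_ h)].
    move=> h; have [Ah|nA] := pselect (A h); last by exists (GRay R0).
    have [Q0 KQ _] := QP h (AH h Ah); have [_ Rkh] := RkP h (AA0 h Ah).
    have := @join_rays _ (Q h) (ray_drop (R_ h) (Rk h).2).
    rewrite Q0 /= addn0 Rkh => /(_ erefl)[n m QR|D [tQ tR DQR]].
      apply: (component_disj (cK h (AH h Ah)) (KQ n)); rewrite QR ZE; right.
      by exists (R_ h); [exact: R_F (AA0 h Ah)|exact: imageT].
    exists (GDRay D) => _; exists D; split=> // v /DQR[[[|n] _ <-]|[n _ <-]].
    - by right; rewrite Q0; exists (Rk h).2.
    - by left.
    - by right; exact: imageT.
  move=> /choice[P PP].
  apply: (@strong_sun_intro A K w_ P (fun h => range (R_ h))) => //.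
  - by move=> h /AH /cK.
  - by move=> h /AH /w_K.
  - by move=> h h' Ah Ah' hh'; have [] := Ar h h' Ah Ah' hh'.
  - move=> h Ah v Rv; rewrite ZE; right; exists (R_ h) => //.
    exact: R_F (AA0 h Ah).
  - move=> h h' Ah Ah' hh'; have [_ Rhh'] := Ar h h' Ah Ah' hh'.
    by apply: Fdisj Rhh'; apply: R_F; exact: AA0.
  - by move=> h Ah; have [D [-> _ _ DK]] := PP h Ah.
  - move=> h Ah wwh; have [D [-> tQ tR _]] := PP h Ah; split=> //.
    exists (ray_drop (R_ h) (Rk h).2), (Q h); split=> //.
      by apply: end_ray_drop; apply: Fw; exact: R_F (AA0 h Ah).
    by have [] := QP h (AH h Ah).
  - by left=> h Ah; have [D [-> _ _ _]] := PP h Ah; exists D.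
(* In the remaining case the rays [Q h] themselves form the sun, since their first vertices [h]
   dominate [w]. *)
have [A [AA0 uncA Ar]] : exists A, [/\ A `<=` H `&` [set v | dominates v w],
    ~ countable A & forall x y, A x -> A y -> x <> y -> K x <> K y].
  apply: uncountable_pairwise udom _ _.
    by move=> x y Kxy; exact: nesym.
  move=> x A0x; apply: sub_countable (conflict_K _ x _ A0x) => [|y []//].
  by apply: subset_card_le => y [A0y /contrapT Kxy].
have AH h : A h -> H h by move=> /AA0[].
apply: (@strong_sun_intro A K w_ (fun h => GRay (Q h)) (fun h => [set h])) => //.
- by move=> h /AH /cK.
- by move=> h /AH /w_K.
- by move=> h /AH /HZ Zh _ ->.
- by move=> h h' Ah Ah' hh'; rewrite -subset0 => v [->].
- move=> h /AH /QP[Q0 KQ _] _ [[|n] _ <-] /=; first by right.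
  by left.
- move=> h Ah wwh; split=> //; right; have [Q0 _ wQ] := QP h (AH h Ah).
  by split=> //; rewrite Q0; have [] := AA0 h Ah.
- right=> h Ah; exists (Q h); have [Q0 _ wQ] := QP h (AH h Ah).
  by split=> //; rewrite Q0; have [] := AA0 h Ah.
Qed.
End Main.

Theorem theorem3p5 (G : graph) (w : end_of G) :
  (~ first_countable_at w <->
   exists (I : Type) (P : I -> gcarrier G) (wi : I -> end_of G),
     uncountable_sun w P wi) /\
  ((exists (I : Type) (P : I -> gcarrier G) (wi : I -> end_of G),
      uncountable_sun w P wi) ->
   exists (I : Type) (P : I -> gcarrier G) (wi : I -> end_of G)
          (T : graph) (c : T) (V : T -> set G),
     [/\ uncountable_sun w P wi,
         uncountable_star_decomposition c V /\ finite_adhesion V,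
         lives_in V w c &
         exists leaf : I -> T,
           injective leaf /\
           forall i, leaf i <> c /\ lives_in V (wi i) (leaf i)]).
Proof.
have sun_nfc : (exists (I : Type) (P : I -> gcarrier G) (wi : I -> end_of G),
    uncountable_sun w P wi) -> ~ first_countable_at w.
  by move=> [I [P [wi h]]]; exact: uncountable_sun_not_first_countable h.
have nfc_sun : ~ first_countable_at w -> strong_sun w.
  have [F [Fw Fdisj [concZ rayZ]]] := envelope w.
  exact: strong_sun_exists Fw Fdisj erefl concZ rayZ.
split; last by move=> /sun_nfc /nfc_sun.
split=> // /nfc_sun[I [P [wi [T [c [V [h _ _ _]]]]]]].
by exists I, P, wi.
Qed.
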